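(* Let $n\ge 0$ be an integer, $N=(n+1)(n+2)/2$, and let $\mathcal{S}=\{\bm s_1,\dots,\bm s_N\}$ be a set of nodes in the closed unit disk $\mathbb{D}$ such that the Zernike collocation matrix $\bm Z_N=\left(Z_{i-1}(\bm s_j)\right)_{i,j=1}^N$ is invertible. Let $\alpha=\pi/6$, let $\varphi$ be the map of $\mathbb{D}$ onto its inscribed regular hexagon given in polar coordinates by $\widetilde\varphi(r,\theta)=(rR_\alpha(\theta),\theta)$, and let $\{H_j\}_{j\ge 0}$ be the hexagonal Zernike functions given in polar coordinates by $\widetilde H_j(\rho,\theta)=\frac{1}{R_\alpha(\theta)}\widetilde Z_j\left(\frac{\rho}{R_\alpha(\theta)},\theta\right)$. Consider the collocation matrix at the transferred nodes, $$\bm H_N:=\left(H_{i-1}(\varphi(\bm s_j))\right)_{i,j=1}^N .$$ Let $\theta_j$ be the polar angle of $\bm s_j=(x_j,y_j)$ (i.e. $\theta_j=\arctan(y_j/x_j)$), and consider the diagonal matrix $\bm D_N:=\operatorname{diag}\left(\frac{1}{R_\alpha(\theta_j)}\right)$, $j=1,\dots,N$. Then, for every $p\in[1,\infty]$, $$\kappa_p(\bm H_N)\le\frac{2\sqrt3}{3}\,\kappa_p(\bm Z_N)\approx 1.15\,\kappa_p(\bm Z_N),$$ where $\kappa_p$ is the matrix condition number induced by the $p$-norm.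
   Context: Zernike circle polynomials: for integers $n\ge 0$ and $m$ with $|m|\le n$ and $n-m$ even, define in polar coordinates $$\widetilde Z_n^m(\rho,\theta)=\begin{cases}N_n^m R_n^{|m|}(\rho)\cos(m\theta), & m\ge 0,\\ N_n^m R_n^{|m|}(\rho)\sin(|m|\theta), & m<0,\end{cases}$$ where $$R_n^{|m|}(\rho)=\sum_{i=0}^{(n-|m|)/2}\frac{(-1)^i(n-i)!}{i!\,((n+|m|)/2-i)!\,((n-|m|)/2-i)!}\,\rho^{n-2i},\qquad N_n^m=\sqrt{\frac{2(n+1)}{1+\delta_{m,0}}}.$$ In single-index notation, $\widetilde Z_j=\widetilde Z_n^m$ with $j=\frac{n(n+2)+m}{2}\in\{0,1,2,\dots\}$, and $Z_j(x,y)$ is $\widetilde Z_j$ written in Cartesian coordinates. The Zernike polynomials of radial order at most $n$ are exactly $Z_0,\dots,Z_{N-1}$ with $N=(n+1)(n+2)/2$. The function $R_\alpha$ (not to be confused with the radial polynomials $R_n^{|m|}$) is defined, for $0\le\theta\le 2\pi$ (and extended to all real $\theta$ by the same formula), by $$R_\alpha(\theta)=\frac{\cos\alpha}{\cos(U_\alpha(\theta))},\qquad U_\alpha(\theta)=\theta-\left\lfloor\frac{\theta+\alpha}{2\alpha}\right\rfloor 2\alpha .$$ For $\alpha=\pi/6$ the map $\widetilde\varphi(r,\theta)=(rR_\alpha(\theta),\theta)$ sends the unit disk bijectively onto the regular hexagon of side $1$ inscribed in the unit circle. $H_j$ denotes the function on the hexagon whose expression in polar coordinates is $\widetilde H_j$.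 If some node $\bm s_j$ is the origin, its polar angle $\theta_j$ is any fixed choice, used consistently for evaluating every $\widetilde H_i$ at $\varphi(\bm s_j)$ and in $\bm D_N$. For an invertible matrix $\bm A$ and $p\in[1,\infty]$, $\|\bm A\|_p$ is the operator norm induced by the vector $p$-norm and $\kappa_p(\bm A)=\|\bm A\|_p\,\|\bm A^{-1}\|_p$. *)

(* Defs.v *)
From HB Require Import structures.
From mathcomp Require Import all_boot all_order all_algebra.
From mathcomp Require Import zify ring lra.
From mathcomp Require Import all_classical all_reals all_analysis.

Set Implicit Arguments.
Unset Strict Implicit.
Unset Printing Implicit Defensive.
Import Order.TTheory GRing.Theory Num.Theory.

Local Open Scope classical_set_scope.
Local Open Scope ring_scope.

Definition zernike_radial (R : realType) (n k : nat) (rho : R) : R :=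
  \sum_(i < ((n - k)./2).+1)
    (-1) ^+ i * (n - i)`!%:R
    / (i`!%:R * ((n + k)./2 - i)`!%:R * ((n - k)./2 - i)`!%:R)
    * rho ^+ (n - 2 * i).

Definition zernike_norm (R : realType) (n : nat) (m : int) : R :=
  Num.sqrt (2 * n.+1%:R / (1 + (m == 0)%:R)).

Definition zernike_nm (R : realType) (n : nat) (m : int) (rho theta : R) : R :=
  zernike_norm R n m * zernike_radial n `|m|%N rho
  * (if 0 <= m then cos (m%:~R * theta) else sin (`|m|%N%:R * theta)).

(* The single index j stands for the unique (n, m) with |m| <= n, n - m even and
   j = (n (n + 2) + m) / 2.  For fixed n these j fill the interval from
   n (n + 1) / 2 to n (n + 3) / 2, so n is the largest k with
   k (k + 1) / 2 <= j. *)
Definition zernike_deg (j : nat) : nat :=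
  \max_(k < j.+1 | ((k * k.+1)./2 <= j)%N) k.

Definition zernike_ord (j : nat) : int :=
  (2 * j)%:Z - (zernike_deg j * (zernike_deg j).+2)%:Z.

Lemma zernike_indexK (n : nat) (m : int) (j : nat) :
  (`|m| <= n)%N -> (2 * j)%:Z = (n * n.+2)%:Z + m ->
  zernike_deg j = n /\ zernike_ord j = m.
Proof.
move=> mn jnm; suff dj : zernike_deg j = n.
  by split=> //; rewrite /zernike_ord dj jnm addrAC subrr add0r.
have hlo : ((n * n.+1)./2 <= j)%N by nia.
have hhi k : ((k * k.+1)./2 <= j)%N -> (k <= n)%N.
  by move=> kj; rewrite leqNgt; apply/negP => nk; nia.
have nj : (n < j.+1)%N by case: (n) hlo => [|n'] hlo //; nia.
apply/eqP; rewrite eqn_leq; apply/andP; split.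
  by apply/bigmax_leqP => k; exact: hhi.
exact: (@leq_bigmax_cond _ _ (fun k : 'I_j.+1 => k : nat) (Ordinal nj)).
Qed.

Lemma zernike_indexP (j : nat) :
  (`|zernike_ord j| <= zernike_deg j)%N
  /\ ~~ odd (zernike_deg j - `|zernike_ord j|).
Proof.
have lo : ((zernike_deg j * (zernike_deg j).+1)./2 <= j)%N.
  rewrite /zernike_deg; apply: (big_ind (fun k => ((k * k.+1)./2 <= j)%N)) => //.
  by move=> a b ha hb; rewrite /maxn; case: ifP.
have hi : (j < ((zernike_deg j).+1 * (zernike_deg j).+2)./2)%N.
  rewrite ltnNge; apply/negP => jd.
  have dj : ((zernike_deg j).+1 < j.+1)%N.
    by move: jd; move: (zernike_deg j) => d; nia.
  have := @leq_bigmax_cond _ (fun k : 'I_j.+1 => (k * k.+1)./2 <= j)%N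
            (fun k : 'I_j.+1 => k : nat) (Ordinal dj) jd.
  by rewrite ltnn.
move: lo hi; rewrite /zernike_ord; move: (zernike_deg j) => n lo hi.
have [e ne] : exists e : nat, (n * n.+1)%N = e.*2.
  by exists ((n * n.+1)./2); rewrite even_halfK// oddM /= andbN.
split; nia.
Qed.

Definition zernike_polar (R : realType) (j : nat) (rho theta : R) : R :=
  zernike_nm (zernike_deg j) (zernike_ord j) rho theta.

(* The number of Zernike polynomials of radial order at most n. *)
Definition zernike_card (n : nat) : nat := (n.+1 * n.+2)./2.

Definition polar_radius (R : realType) (z : R * R) : R :=
  Num.sqrt (z.1 ^+ 2 + z.2 ^+ 2).

(* The quadrant-correct arctan (y / x), in [0, 2 pi[; the angle of the origin
   is the parameter [t0]. *)
Definition polar_angle (R : realType) (t0 : R) (z : R * R) : R :=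
  if z == (0, 0) then t0
  else if 0 <= z.2 then acos (z.1 / polar_radius z)
  else 2 * pi - acos (z.1 / polar_radius z).

Definition of_polar (R : realType) (r theta : R) : R * R :=
  (r * cos theta, r * sin theta).

Lemma polar_angleK (R : realType) (t0 : R) (z : R * R) :
  of_polar (polar_radius z) (polar_angle t0 z) = z.
Proof.
case: z => x y; rewrite /of_polar /polar_angle /polar_radius /=.
case: eqP => [[-> ->]|/eqP z0]; first by rewrite expr0n addr0 sqrtr0 !mul0r.
have s_ge0 : 0 <= x ^+ 2 + y ^+ 2 by rewrite addr_ge0 ?sqr_ge0.
have s_neq0 : x ^+ 2 + y ^+ 2 != 0.
  by rewrite paddr_eq0 ?sqr_ge0// !sqrf_eq0 -xpair_eqE.
have s_gt0 : 0 < x ^+ 2 + y ^+ 2 by rewrite lt_neqAle eq_sym s_neq0.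
set r := Num.sqrt _; have r_gt0 : 0 < r by rewrite sqrtr_gt0.
have r_neq0 : r != 0 by rewrite gt_eqF.
have r2 : r ^+ 2 = x ^+ 2 + y ^+ 2 by rewrite sqr_sqrtr.
have xr : -1 <= x / r <= 1.
  by rewrite ler_pdivlMr// ler_pdivrMr//; apply/andP; split; nra.
have yr : r * Num.sqrt (1 - (x / r) ^+ 2) = `|y|.
  have -> : 1 - (x / r) ^+ 2 = (y / r) ^+ 2.
    rewrite !expr_div_n; apply: (mulIf (expf_neq0 2 r_neq0)).
    by rewrite mulrBl !divfK ?expf_neq0// mul1r r2 addrAC subrr add0r.
  by rewrite sqrtr_sqr normrM normfV (gtr0_norm r_gt0) mulrC divfK.
have cK : cos (acos (x / r)) = x / r by rewrite acosK// in_itv.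
case: ifPn => y0.
  by rewrite cK sin_acos// yr ger0_norm// mulrC divfK.
rewrite addrC mulr_natl cosD2pi sinD2pi cosN sinN cK sin_acos// mulrN yr.
by rewrite ltr0_norm ?ltNge// opprK mulrC divfK.
Qed.

(* [zernike_polar] in Cartesian coordinates.  Its value at rho = 0 does not
   depend on the angle, so the choice of angle 0 at the origin is immaterial. *)
Definition zernike (R : realType) (j : nat) (z : R * R) : R :=
  zernike_polar j (polar_radius z) (polar_angle 0 z).

Lemma zernike_polar0 (R : realType) (j : nat) (t t' : R) :
  zernike_polar j 0 t = zernike_polar j 0 t'.
Proof.
rewrite /zernike_polar /zernike_nm; have [] := zernike_indexP j.
move: (zernike_deg j) (zernike_ord j) => n m mn nm.
have [->|m0] := eqVneq m 0; first by rewrite lexx !mul0r.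
rewrite [zernike_radial _ _ _]big1 ?mulr0 ?mul0r// => i _.
rewrite expr0n; case: eqP => [ni|_]; last by rewrite mulr0.
have := ltn_ord i; lia.
Qed.

Definition sector_U (R : realType) (alpha theta : R) : R :=
  theta - (Num.floor ((theta + alpha) / (2 * alpha)))%:~R * (2 * alpha).

(* The distance from the origin, in direction [theta], to the boundary of the
   regular polygon with central half-angle [alpha] inscribed in the unit circle;
   [alpha = pi / 6] gives the hexagon. *)
Definition sector_R (R : realType) (alpha theta : R) : R :=
  cos alpha / cos (sector_U alpha theta).

(* [t0] is the polar angle given to the origin, here and in [sector_zernike]. *)
Definition sector_map (R : realType) (alpha t0 : R) (z : R * R) : R * R :=
  let theta := polar_angle t0 z in
  of_polar (polar_radius z * sector_R alpha theta) theta.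

Definition sector_zernike_polar (R : realType) (alpha : R) (j : nat)
    (rho theta : R) : R :=
  (sector_R alpha theta)^-1 * zernike_polar j (rho / sector_R alpha theta) theta.

Definition sector_zernike (R : realType) (alpha t0 : R) (j : nat)
    (z : R * R) : R :=
  sector_zernike_polar alpha j (polar_radius z) (polar_angle t0 z).

(* Only meaningful for 1 <= p; the value at -oo is junk. *)
Definition lp_norm (R : realType) (p : \bar R) (n : nat) (x : 'cV[R]_n) : R :=
  match p with
  | q%:E => (\sum_i `|x i 0| `^ q) `^ q^-1
  | +oo%E => \big[Num.max/0]_i `|x i 0|
  | -oo%E => 0
  end.

Definition op_norm (R : realType) (p : \bar R) (n : nat) (A : 'M[R]_n) : R :=
  sup [set lp_norm p (A *m x) / lp_norm p x | x in [set x | x != 0]].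

(* Only meaningful for invertible [A], as [invmx A = A] otherwise. *)
Definition cond_num (R : realType) (p : \bar R) (n : nat) (A : 'M[R]_n) : R :=
  op_norm p A * op_norm p (invmx A).

(* Main.v *)
Require Import Defs.
From mathcomp Require Import all_boot all_order all_algebra.
From mathcomp Require Import all_classical all_reals all_analysis.
From mathcomp Require Import ring lra.
Set Implicit Arguments.
Unset Strict Implicit.
Unset Printing Implicit Defensive.
Import Order.TTheory GRing.Theory Num.Theory.
Local Open Scope ring_scope.

(** The map [sector_map] moves a node along its ray from the origin by the
    positive factor [sector_R alpha theta_j], so it keeps the polar angle, and the
    rescaling inside the hexagonal functions undoes exactly this stretching.
    Hence evaluating at the transferred nodes only multiplies the [j]-th
    column of the Zernike collocation matrix by [1 / sector_R alpha theta_j]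
    ([sector_zernike_map]), i.e. [H_N = Z_N *m D_N].

    A right diagonal factor with entries of modulus in [[a, b]] inflates any
    condition number induced by a norm monotone in the moduli of the
    coordinates by at most [b / a] ([cond_num_mul_diag]): it costs [b] in the
    norm of the matrix and [a^-1] in the norm of its inverse.  As the boundary
    of the regular polygon lies between its inscribed and circumscribed
    circles, [cos alpha <= sector_R alpha theta <= 1] ([sector_R_itv]), so here
    [a = 1] and [b = 1 / cos (pi / 6) = 2 * sqrt 3 / 3]. *)

(** * Vector p-norms *)

Lemma lp_norm_ge0 (R : realType) (p : \bar R) (n : nat) (x : 'cV[R]_n) :
  0 <= lp_norm p x.
Proof.
case: p => [q||] //=; first exact: powR_ge0.
exact: bigmax_ge_id.
Qed.

(** Monotonicity in the moduli of the coordinates is what lets a diagonal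
    matrix act on the norm by at most its largest modulus. *)
Lemma lp_norm_le (R : realType) (p : \bar R) (n : nat) (c : R)
    (x y : 'cV[R]_n) :
  (1 <= p)%E -> 0 <= c -> (forall i, `|x i 0| <= c * `|y i 0|) ->
  lp_norm p x <= c * lp_norm p y.
Proof.
case: p => [q||] //= p1 c0 xy.
- have q0 : 0 < q by rewrite lee_fin in p1; exact: lt_le_trans p1.
  have S0 (z : 'cV[R]_n) : 0 <= \sum_i `|z i 0| `^ q.
    by apply: sumr_ge0 => i _; exact: powR_ge0.
  have cE : c = (c `^ q) `^ q^-1 by rewrite -powRrM divff ?gt_eqF// powRr1.
  rewrite [X in X * _]cE -powRM ?powR_ge0//.
  apply: ge0_ler_powR; rewrite ?nnegrE ?invr_ge0 ?S0 ?(ltW q0)//.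
    by rewrite mulr_ge0 ?powR_ge0.
  rewrite mulr_sumr; apply: ler_sum => i _; rewrite -powRM//.
  by apply: ge0_ler_powR; rewrite ?nnegrE ?mulr_ge0// ltW.
- apply: bigmax_le => [|i _]; first by rewrite mulr_ge0// bigmax_ge_id.
  apply: le_trans (xy i) _; apply: ler_wpM2l => //.
  exact: (le_bigmax 0 (fun i => `|y i 0|)).
Qed.

Lemma abs_le_lp_norm (R : realType) (p : \bar R) (n : nat) (x : 'cV[R]_n) i :
  (1 <= p)%E -> `|x i 0| <= lp_norm p x.
Proof.
case: p => [q||] //= p1; last exact: (le_bigmax 0 (fun i => `|x i 0|)).
have q0 : 0 < q by rewrite lee_fin in p1; exact: lt_le_trans p1.
have xE : `|x i 0| = (`|x i 0| `^ q) `^ q^-1.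
  by rewrite -powRrM divff ?gt_eqF// powRr1.
rewrite [X in X <= _]xE; apply: ge0_ler_powR; rewrite ?nnegrE ?invr_ge0.
- exact: ltW.
- exact: powR_ge0.
- by apply: sumr_ge0 => j _; exact: powR_ge0.
- by rewrite (bigD1 i)//= lerDl; apply: sumr_ge0 => j _; exact: powR_ge0.
Qed.

Lemma lp_norm_gt0 (R : realType) (p : \bar R) (n : nat) (x : 'cV[R]_n) :
  (1 <= p)%E -> x != 0 -> 0 < lp_norm p x.
Proof.
move=> p1 /cV0Pn[i xi].
by apply: lt_le_trans (abs_le_lp_norm x i p1); rewrite normr_gt0.
Qed.

Lemma lp_norm0 (R : realType) (p : \bar R) (n : nat) :
  (1 <= p)%E -> lp_norm p (0 : 'cV[R]_n) = 0.
Proof.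
move=> p1; apply/eqP; rewrite eq_le lp_norm_ge0 andbT.
rewrite -(mul0r (lp_norm p (0 : 'cV[R]_n))); apply: lp_norm_le => // i.
by rewrite mxE normr0 mulr0.
Qed.

(** * Operator norms and condition numbers *)

(** In finite dimension the quotients defining [op_norm] are bounded, so their
    supremum is a genuine one: each coordinate of [A *m x] is at most the sum
    of the moduli of all entries of [A] times [lp_norm p x]. *)
Lemma lp_norm_mulmx_bounded (R : realType) (p : \bar R) (n : nat)
    (A : 'M[R]_n) :
  (1 <= p)%E -> exists C, forall x : 'cV[R]_n,
    lp_norm p (A *m x) <= C * lp_norm p x.
Proof.
move=> p1; pose S := \sum_i \sum_j `|A i j|.
have S0 : 0 <= S by apply: sumr_ge0 => i _; apply: sumr_ge0.
exists (S * lp_norm p (const_mx 1 : 'cV[R]_n)) => x.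
rewrite mulrAC; apply: lp_norm_le => // [|i].
  by rewrite mulr_ge0// lp_norm_ge0.
rewrite !mxE normr1 mulr1; apply: le_trans (ler_norm_sum _ _ _) _.
apply: (@le_trans _ _ ((\sum_j `|A i j|) * lp_norm p x)).
  rewrite mulr_suml; apply: ler_sum => j _.
  by rewrite normrM ler_wpM2l// abs_le_lp_norm.
rewrite ler_wpM2r ?lp_norm_ge0// /S [X in _ <= X](bigD1 i)//= lerDl.
by apply: sumr_ge0 => k _; apply: sumr_ge0.
Qed.

Lemma lp_norm_mulmx (R : realType) (p : \bar R) (n : nat)
    (A : 'M[R]_n) (x : 'cV[R]_n) :
  (1 <= p)%E -> lp_norm p (A *m x) <= op_norm p A * lp_norm p x.
Proof.
move=> p1; have [->|x0] := eqVneq x 0; first by rewrite mulmx0 lp_norm0 ?mulr0.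
rewrite -ler_pdivrMr ?lp_norm_gt0//; apply: sup_upper_bound; last by exists x.
split; first by exists (lp_norm p (A *m x) / lp_norm p x); exists x.
have [C AC] := lp_norm_mulmx_bounded A p1.
by exists C => _ [y /= y0 <-]; rewrite ler_pdivrMr ?lp_norm_gt0.
Qed.

Lemma op_norm_le (R : realType) (p : \bar R) (n : nat) (A : 'M[R]_n) (c : R) :
  (1 <= p)%E -> (0 < n)%N ->
  (forall x, lp_norm p (A *m x) <= c * lp_norm p x) -> op_norm p A <= c.
Proof.
move=> p1 n0 Ac; apply: ge_sup; last first.
  by move=> _ [y /= y0 <-]; rewrite ler_pdivrMr ?lp_norm_gt0.
pose e : 'cV[R]_n := const_mx 1.
exists (lp_norm p (A *m e) / lp_norm p e); exists e => //=.
by apply/cV0Pn; exists (Ordinal n0); rewrite mxE oner_eq0.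
Qed.

Lemma op_norm_ge0 (R : realType) (p : \bar R) (n : nat) (A : 'M[R]_n) :
  (1 <= p)%E -> (0 < n)%N -> 0 <= op_norm p A.
Proof.
move=> p1 n0; pose e : 'cV[R]_n := const_mx 1.
have e0 : 0 < lp_norm p e.
  apply: lp_norm_gt0 => //.
  by apply/cV0Pn; exists (Ordinal n0); rewrite mxE oner_eq0.
rewrite -(pmulr_lge0 _ e0).
exact: le_trans (lp_norm_ge0 _ _) (lp_norm_mulmx A e p1).
Qed.

Lemma mulmx_diag_unit (F : fieldType) (n : nat) (A : 'M[F]_n) (d : 'rV[F]_n) :
  A \in unitmx -> (forall j, d 0 j != 0) -> A *m diag_mx d \in unitmx.
Proof.
move=> Au d0; rewrite unitmx_mul Au unitmxE det_diag unitfE.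
by apply/prodf_neq0 => j _.
Qed.

Lemma op_norm_mul_diag (R : realType) (p : \bar R) (n : nat)
    (A : 'M[R]_n) (d : 'rV[R]_n) (b : R) :
  (1 <= p)%E -> (0 < n)%N -> 0 <= b -> (forall j, `|d 0 j| <= b) ->
  op_norm p (A *m diag_mx d) <= op_norm p A * b.
Proof.
move=> p1 n0 b0 db; apply: op_norm_le => // x; rewrite -mulmxA -mulrA.
apply: le_trans (lp_norm_mulmx _ _ p1) _; apply: ler_wpM2l.
  exact: op_norm_ge0.
by apply: lp_norm_le => // i; rewrite mul_diag_mx mxE normrM ler_wpM2r.
Qed.

Lemma op_norm_invmx_mul_diag (R : realType) (p : \bar R) (n : nat)
    (A : 'M[R]_n) (d : 'rV[R]_n) (a : R) :
  (1 <= p)%E -> (0 < n)%N -> A \in unitmx ->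
  0 < a -> (forall j, a <= `|d 0 j|) ->
  op_norm p (invmx (A *m diag_mx d)) <= a^-1 * op_norm p (invmx A).
Proof.
move=> p1 n0 Au a0 da; apply: op_norm_le => // x.
have d0 j : d 0 j != 0 by rewrite -normr_gt0 (lt_le_trans a0).
have ADu := mulmx_diag_unit Au d0.
set y := invmx _ *m x.
(* [y] solves [A D y = x], so that [A^-1 x = D y] dominates [a |y|]. *)
have -> : x = A *m (diag_mx d *m y) by rewrite mulmxA mulKVmx.
move: y => {ADu} y; rewrite -mulrA; apply: (@le_trans _ _ (a^-1 * lp_norm p (diag_mx d *m y))).
  apply: lp_norm_le => // [|i]; first by rewrite invr_ge0 ltW.
  rewrite mul_diag_mx mxE normrM mulrA ler_peMl// mulrC ler_pdivlMr//.
  by rewrite mul1r.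
rewrite ler_wpM2l ?invr_ge0 ?(ltW a0)//.
by rewrite -[X in lp_norm p X <= _](mulKmx Au) lp_norm_mulmx.
Qed.

Lemma cond_num_mul_diag (R : realType) (p : \bar R) (n : nat)
    (A : 'M[R]_n) (d : 'rV[R]_n) (a b : R) :
  (1 <= p)%E -> (0 < n)%N -> A \in unitmx ->
  0 < a -> (forall j, a <= `|d 0 j| <= b) ->
  cond_num p (A *m diag_mx d) <= b / a * cond_num p A.
Proof.
move=> p1 n0 Au a0 dab.
have b0 : 0 <= b.
  by have /andP[_] := dab (Ordinal n0); apply: le_trans; exact: normr_ge0.
have -> : b / a * cond_num p A =
    (op_norm p A * b) * (a^-1 * op_norm p (invmx A)).
  by rewrite /cond_num; ring.
rewrite /cond_num; apply: ler_pM; rewrite ?op_norm_ge0//.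
  by apply: op_norm_mul_diag => // j; case/andP: (dab j).
by apply: op_norm_invmx_mul_diag => // j; case/andP: (dab j).
Qed.

(** * Polar coordinates and the polygonal functions *)

Lemma polar_radius_scale (R : realType) (c : R) (z : R * R) :
  0 <= c -> polar_radius (c * z.1, c * z.2) = c * polar_radius z.
Proof.
move=> c0; rewrite /polar_radius /= !exprMn -mulrDr sqrtrM ?sqr_ge0//.
by rewrite sqrtr_sqr ger0_norm.
Qed.

Lemma polar_angle_scale (R : realType) (c t0 : R) (z : R * R) :
  0 < c -> polar_angle t0 (c * z.1, c * z.2) = polar_angle t0 z.
Proof.
move=> c0; rewrite /polar_angle polar_radius_scale ?(ltW c0)//=.
rewrite pmulr_rge0// -mulf_div divff ?gt_eqF// mul1r.
case: z => x y /=.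
by rewrite !xpair_eqE !mulf_eq0 !(gt_eqF c0).
Qed.

Lemma sector_map_scale (R : realType) (alpha t0 : R) (z : R * R) :
  let c := sector_R alpha (polar_angle t0 z) in
  sector_map alpha t0 z = (c * z.1, c * z.2).
Proof.
move=> c; rewrite -{2 3}(polar_angleK t0 z) /sector_map /of_polar /= -/c.
by congr pair; ring.
Qed.

(** At the origin the two sides may use different polar angles, [t0] and [0],
    but there no Zernike polynomial depends on the angle. *)
Lemma sector_zernike_map (R : realType) (alpha t0 : R) (j : nat) (z : R * R) :
  let c := sector_R alpha (polar_angle t0 z) in
  0 < c ->
  sector_zernike alpha t0 j (sector_map alpha t0 z) = c^-1 * zernike j z.
Proof.
move=> c c0; rewrite /sector_zernike /sector_zernike_polar sector_map_scale.
rewrite -/c polar_angle_scale// polar_radius_scale ?(ltW c0)// -/c.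
rewrite mulrAC divff ?gt_eqF// mul1r /zernike; congr (_ * _).
have [->|z0] := eqVneq z (0, 0); last by rewrite /polar_angle (negPf z0).
by rewrite /polar_radius /= expr0n addr0 sqrtr0; exact: zernike_polar0.
Qed.

Lemma sector_U_itv (R : realType) (alpha theta : R) :
  0 < alpha -> `|sector_U alpha theta| <= alpha.
Proof.
move=> a0; rewrite /sector_U; set f := (Num.floor _)%:~R.
have a20 : 0 < 2 * alpha by rewrite mulr_gt0.
have /andP[] := floor_itv ((theta + alpha) / (2 * alpha)).
rewrite intrD1 -/f ler_pdivlMr// ltr_pdivrMr// mulrDl mul1r => lo hi.
by rewrite ler_norml; apply/andP; split; lra.
Qed.

Lemma sector_R_itv (R : realType) (alpha theta : R) :
  0 < alpha < pi / 2 -> cos alpha <= sector_R alpha theta <= 1.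
Proof.
move=> /andP[a0 api]; have Ua := sector_U_itv theta a0.
have ca : 0 < cos alpha.
  by apply: cos_gt0_pihalf; rewrite api andbT; lra.
have caU : cos alpha <= cos (sector_U alpha theta).
  rewrite -(cos_norm (sector_U _ _)) leNgt; apply/negP.
  have pi0 := pi_ge0 R.
  rewrite ltr_cos ?in_itv/= ?normr_ge0 ?(ltW a0)/=; lra.
have cU : 0 < cos (sector_U alpha theta) by exact: lt_le_trans caU.
rewrite /sector_R ler_pdivlMr// ler_pdivrMr// mul1r caU andbT.
by rewrite ger_pMr// cos_le1.
Qed.

(** Since [3 * (pi / 6)] is a right angle, the triple angle formula
    [cos (3 x) = 4 (cos x)^3 - 3 cos x] gives [4 (cos (pi / 6))^2 = 3]. *)
Lemma cos_pi6 (R : realType) : cos (pi / 6) = Num.sqrt 3 / 2 :> R.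
Proof.
have pi0 := pi_gt0 R; set x : R := pi / 6.
have c0 : 0 < cos x by apply: cos_gt0_pihalf; rewrite /x; lra.
have : cos (x + x *+ 2) = 0.
  by rewrite -(@cos_pihalf R); congr cos; rewrite /x mulr2n; lra.
rewrite cosD cos_mulr2n sin_mulr2n => c3.
have s2 : sin x ^+ 2 = 1 - cos x ^+ 2 by rewrite sin2cos2.
have /eqP : cos x * (4 * cos x ^+ 2 - 3) = 0.
  by rewrite -[RHS]c3; ring: s2.
rewrite mulf_eq0 (gt_eqF c0)/= => /eqP c2.
have -> : 3 = (2 * cos x) ^+ 2 :> R by rewrite exprMn; lra.
by rewrite sqrtr_sqr ger0_norm ?mulr_ge0 ?ltW// mulrAC divff ?mul1r.
Qed.

(** The bounds are [1.5 * (1.15 -+ 0.005)], so that [2 * sqrt 3 / 3] is within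
    [0.005] of [1.15]. *)
Lemma sqrt3_approx (R : realType) :
  687 / 400 < Num.sqrt (3 : R) < 693 / 400.
Proof.
have s0 : 0 <= Num.sqrt 3 :> R by exact: sqrtr_ge0.
have s2 : Num.sqrt 3 ^+ 2 = 3 :> R by rewrite sqr_sqrtr.
by apply/andP; split; nra.
Qed.

Theorem proposition4p2 (R : realType) (n : nat)
    (s : 'I_(zernike_card n) -> R * R) (t0 : R) :
  let N := zernike_card n in
  let alpha : R := pi / 6 in
  let Z_N : 'M[R]_N := \matrix_(i < N, j < N) zernike i (s j) in
  let H_N : 'M[R]_N :=
    \matrix_(i < N, j < N)
      sector_zernike alpha t0 i (sector_map alpha t0 (s j)) in
  let theta (j : 'I_N) : R := polar_angle t0 (s j) in
  let D_N : 'M[R]_N := diag_mx (\row_(j < N) (sector_R alpha (theta j))^-1) in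
  (forall j, (s j).1 ^+ 2 + (s j).2 ^+ 2 <= 1) ->
  Z_N \in unitmx ->
  H_N \in unitmx /\
  (forall p : \bar R, (1 <= p)%E ->
     cond_num p H_N <= 2 * Num.sqrt 3 / 3 * cond_num p Z_N) /\
  `|2 * Num.sqrt 3 / 3 - 115 / 100| < 5 / 1000 :> R.
Proof.
move=> N alpha Z_N H_N theta D_N _ Zu.
have pi0 := pi_gt0 R.
have s30 : 0 < Num.sqrt 3 :> R by rewrite sqrtr_gt0.
have ca : cos alpha = Num.sqrt 3 / 2 by exact: cos_pi6.
have ca0 : 0 < cos alpha by rewrite ca divr_gt0.
have Ritv t : cos alpha <= sector_R alpha t <= 1.
  by apply: sector_R_itv; rewrite /alpha; apply/andP; split; lra.
have R0 t : 0 < sector_R alpha t.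
  by have /andP[+ _] := Ritv t; exact: lt_le_trans.
have HE : H_N = Z_N *m D_N.
  by apply/matrixP => i j; rewrite mul_mx_diag !mxE sector_zernike_map// mulrC.
have N0 : (0 < N)%N by rewrite /N /zernike_card mulSn.
split; first by rewrite HE mulmx_diag_unit// => j; rewrite mxE invr_neq0// gt_eqF.
split=> [p p1|]; last first.
  by have /andP[lo hi] := sqrt3_approx R; rewrite ltr_norml; apply/andP; split; lra.
have -> : 2 * Num.sqrt 3 / 3 = (cos alpha)^-1 / 1 :> R.
  have s2 : Num.sqrt 3 * Num.sqrt 3 = 3 :> R by rewrite -expr2 sqr_sqrtr.
  rewrite divr1 ca invf_div -{2}s2 -mulf_div.
  by rewrite divff ?mulr1 ?gt_eqF.
rewrite HE; apply: cond_num_mul_diag => // j; rewrite mxE.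
have /andP[lo hi] := Ritv (theta j).
rewrite ger0_norm ?invr_ge0 ?(ltW (R0 _))//.
by rewrite invr_ge1 ?unitfE ?gt_eqF// hi lef_pV2 ?posrE ?R0.
Qed.
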